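(* Let $k\ge 2$ be an integer. Then $|\mathcal C_{k,n}| = 0$ if $1\le n\le 2k-2$; $|\mathcal C_{k,n}| = 1$ if $2k-1\le n\le 2k$; and $|\mathcal C_{k,n}| = 2$ if $n=2k+1$. For every integer $n\ge 2k+2$, $$|\mathcal C_{k,n}| = |\mathcal C_{k,n-1}|+|\mathcal C_{k,n-2}|-|\mathcal C_{k,n-3}|+|\mathcal C_{k,n-(2k+1)}|.$$
   Context: $\mathbb N=\{1,2,3,\dots\}$ and $[n]=\{1,2,\dots,n\}$. A finite nonempty set $F\subset\mathbb N$ is called Schreier if $\min F\ge |F|$. For $k\in\mathbb N$, a nonempty set $F\subset \mathbb N$ is called $k$-clustered if for every $a\in F$ there exists an interval of consecutive integers $I\subseteq F$ such that $a\in I$ and $|I|\ge k$. For $k,n\in\mathbb N$, $\mathcal C_{k,n}:=\{F\subset[n] : n\in F,\ F \text{ is Schreier, and } F \text{ is } k\text{-clustered}\}$. *)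

(* Defs.v *)
From mathcomp Require Import all_boot all_order all_algebra finmap.
From mathcomp Require Import boolp.

Set Implicit Arguments.
Unset Strict Implicit.
Unset Printing Implicit Defensive.

Local Open Scope fset_scope.

(* The integers a, a + 1, ..., b (the empty set when b < a). *)
Definition interval (a b : nat) : {fset nat} := [fset x in iota a (b.+1 - a)].

Definition is_interval (I : {fset nat}) : Prop := exists a b, I = interval a b.

(* The default value \max F is neutral for minn on F, so for F nonempty this
   is the least element of F, see fminP. *)
Definition fmin (F : {fset nat}) : nat :=
  \big[minn/(\max_(x <- F) x)%N]_(x <- F) x.

(* Sets of positive integers are encoded as sets of type {fset nat}; 0 is
   excluded from a Schreier set because 0 < #|` F | <= fmin F. *)
Definition schreier (F : {fset nat}) : Prop :=
  F != fset0 /\ (#|` F | <= fmin F)%N.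

Definition clustered (k : nat) (F : {fset nat}) : Prop :=
  F != fset0 /\
  forall a, a \in F -> exists I : {fset nat},
    [/\ is_interval I, I `<=` F, a \in I & (k <= #|` I |)%N].

Definition C (k n : nat) : {fset {fset nat}} :=
  [fset F in fpowerset (interval 1 n) |
    `[< [/\ n \in F, schreier F & clustered k F] >]].

Lemma in_interval a b x : (x \in interval a b) = (a <= x <= b)%N.
Proof.
rewrite /interval inE mem_iota; case: (leqP a x) => //= ax.
case: (leqP a b.+1) => ab; first by rewrite subnKC.
have -> : (b.+1 - a = 0)%N by apply/eqP; rewrite subn_eq0 ltnW.
rewrite addn0 ltnNge ax /=; symmetry; apply/negbTE; rewrite -ltnNge.
exact: leq_trans (ltnW ab) ax.
Qed.

Lemma in_C k n F : F \in C k n <->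
  [/\ F `<=` interval 1 n, n \in F, schreier F & clustered k F].
Proof.
rewrite /C !inE fpowersetE; split.
  by move=> /andP[FN /asboolP[]].
by move=> [FN ? ? ?]; rewrite FN; apply/asboolP.
Qed.

Lemma fminP F : F != fset0 ->
  fmin F \in F /\ forall x, x \in F -> (fmin F <= x)%N.
Proof.
have minle (s : seq nat) d x : x \in s -> (\big[minn/d]_(y <- s) y <= x)%N.
  elim: s => // y s IH; rewrite inE big_cons geq_min.
  by move=> /orP[/eqP->|/IH->]; rewrite ?leqnn ?orbT.
have minin (s : seq nat) d :
    (\big[minn/d]_(y <- s) y == d) || (\big[minn/d]_(y <- s) y \in s).
  elim: s => [|y s IH]; first by rewrite big_nil eqxx.
  rewrite big_cons inE; set m := \big[_/_]_(_ <- _) _ in IH *.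
  case: (leqP y m) => _; first by rewrite eqxx orbT.
  by case/orP: IH => ->; rewrite ?orbT.
have maxin (s : seq nat) : s != [::] -> (\max_(y <- s) y)%N \in s.
  elim: s => // y s IH _; rewrite big_cons inE.
  case: (s =P [::]) => [->|/eqP /IH ms]; first by rewrite big_nil maxn0 eqxx.
  by case: (leqP y _) => _; rewrite ?ms ?eqxx ?orbT.
move=> F0; split; last by move=> x; exact: minle.
have F0' : (F : seq nat) != [::].
  apply: contraNneq F0 => FE; apply/eqP/fsetP=> x.
  by rewrite in_fset0 -[x \in F]/(x \in (F : seq nat)) FE.
rewrite /fmin; case/orP: (minin F (\max_(x <- F) x)%N) => // /eqP->.
exact: maxin.
Qed.

(* Main.v *)
(** Reflecting [F] through its maximum [n] turns the members of [C k n] into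
    the [k]-clustered sets [R] of naturals with [0 \in R] and
    [#|R| + max R <= n]; these families [E k n] increase with [n].  A set of
    weight [#|R| + max R] exactly [n] starts with a run of length at least [k].
    If this run is longer than [k], deleting [0] and shifting down by one gives
    an arbitrary set of weight [n - 2].  If it has length exactly [k], then
    deleting it, together with the gap that follows, gives an arbitrary set of
    weight at most [n - (2k + 1)], the length of the gap being determined by
    [n]; only [R = {0, ..., k - 1}], of weight [2k - 1], has nothing left.
    Hence for [n >= 2k]
    [|E n| - |E (n - 1)| = (|E (n - 2)| - |E (n - 3)|) + |E (n - (2k + 1))|]. *)
Require Import Defs.
From mathcomp Require Import all_boot all_order all_algebra finmap.
From mathcomp Require Import boolp zify.

Set Implicit Arguments.
Unset Strict Implicit.
Unset Printing Implicit Defensive.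

Local Open Scope fset_scope.

(* [all_algebra] has its own [interval], on ordered types. *)
Local Notation interval := Defs.interval.

(** * Shifts, reflections and weights of finite sets *)

Definition shift_up (t : nat) (G : {fset nat}) : {fset nat} :=
  [fset (x + t)%N | x in G].

(** Elements below [t] are discarded first, since truncated subtraction would send them to 0. *)
Definition shift_down (t : nat) (R : {fset nat}) : {fset nat} :=
  [fset (x - t)%N | x in [fset y in R | (t <= y)%N]].

Definition reflect_at (n : nat) (F : {fset nat}) : {fset nat} :=
  [fset (n - x)%N | x in F].

Definition fmax (R : {fset nat}) : nat := (\max_(x <- R) x)%N.

Definition weight (R : {fset nat}) : nat := (#|` R| + fmax R)%N.

(** The clustering condition with windows of exactly [k] integers, named by their left end [b] so
    that linear arithmetic applies. *)
Definition windowed (k : nat) (R : {fset nat}) : Prop :=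
  forall a, a \in R -> exists2 b, (b <= a < b + k)%N &
    forall i, (b <= i < b + k)%N -> i \in R.

Definition E (k n : nat) : {fset {fset nat}} :=
  [fset R in fpowerset (interval 0 n) |
    `[< [/\ 0%N \in R, (weight R <= n)%N & windowed k R] >]].

Lemma in_shift_up t G x : (x \in shift_up t G) = (t <= x)%N && (x - t \in G)%N.
Proof.
apply/imfsetP/andP => [[y /= yG ->]|[tx xG]].
  by rewrite leq_addl addnK.
by exists (x - t)%N; rewrite // subnK.
Qed.

Lemma in_shift_down t R x : (x \in shift_down t R) = (x + t \in R)%N.
Proof.
apply/imfsetP/idP => [[y /=]|xR].
  by rewrite !inE /= => /andP[yR ty] ->; rewrite subnK.
by exists (x + t)%N; rewrite /= ?addnK // !inE /= xR leq_addl.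
Qed.

Lemma in_reflect n F x : F `<=` interval 0 n ->
  (x \in reflect_at n F) = (x <= n)%N && (n - x \in F)%N.
Proof.
move=> /fsubsetP Fn; apply/imfsetP/andP => [[y /= yF ->]|[xn xF]].
  have := Fn _ yF; rewrite in_interval => /andP[_ yn].
  by rewrite subKn // leq_subr.
by exists (n - x)%N; rewrite // subKn.
Qed.

Lemma card_interval a b : #|` interval a b| = (b.+1 - a)%N.
Proof.
by rewrite /interval card_fseq undup_id ?iota_uniq // size_iota.
Qed.

Lemma card_shift_up t G : #|` shift_up t G| = #|` G|.
Proof. by apply: card_imfset => x y /addIn. Qed.

Lemma card_reflect n F : F `<=` interval 0 n -> #|` reflect_at n F| = #|` F|.
Proof.
move=> /fsubsetP Fn; apply: card_in_imfset => x y /= xF yF.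
have := Fn _ xF; have := Fn _ yF; rewrite !in_interval; lia.
Qed.

Lemma leq_fmax R x : x \in R -> (x <= fmax R)%N.
Proof. by move=> xR; exact: (@leq_bigmax_seq _ _ xpredT id). Qed.

Lemma fmax_in R x : x \in R -> fmax R \in R.
Proof.
have maxin (s : seq nat) : s != [::] -> (\max_(y <- s) y)%N \in s.
  elim: s => // y s IH _; rewrite big_cons inE.
  case: (s =P [::]) => [->|/eqP /IH ms]; first by rewrite big_nil maxn0 eqxx.
  by case: (leqP y _) => _; rewrite ?ms ?eqxx ?orbT.
move=> xR; apply: maxin; apply: contraTneq xR => R0.
by rewrite -[x \in R]/(x \in (R : seq nat)) R0.
Qed.

Lemma fmax_eq R m : m \in R -> (forall x, x \in R -> x <= m)%N -> fmax R = m.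
Proof.
move=> mR Rm; apply/eqP; rewrite eqn_leq leq_fmax // andbT.
exact: Rm (fmax_in mR).
Qed.

Lemma in_E k n R : R \in E k n <->
  [/\ 0%N \in R, (weight R <= n)%N & windowed k R].
Proof.
rewrite /E !inE fpowersetE; split; first by move=> /andP[_ /asboolP].
move=> H; apply/andP; split; last exact/asboolP.
case: H => _ wR _; apply/fsubsetP => x xR; rewrite in_interval /=.
by apply: leq_trans (leq_fmax xR) (leq_trans (leq_addl _ _) wR).
Qed.

(** * Reflection of Schreier clustered sets *)

Lemma clusteredE k F : (0 < k)%N ->
  clustered k F <-> F != fset0 /\ windowed k F.
Proof.
move=> k0; split=> -[F0 H]; split=> // a aF.
  have [_ [[c [d ->]] /fsubsetP IF aI]] := H a aF.
  rewrite card_interval => kI; rewrite in_interval in aI.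
  (* The window starts at [a] unless it would pass [d]; then it is the one ending at [d]. *)
  exists (minn a (d.+1 - k)); first by lia.
  by move=> i iI; apply: IF; rewrite in_interval; lia.
have [b ab bF] := H a aF; exists (interval b (b + k).-1); split.
- by exists b, (b + k).-1.
- by apply/fsubsetP => x; rewrite in_interval => xI; apply: bF; lia.
- by rewrite in_interval; lia.
- by rewrite card_interval; lia.
Qed.

Lemma schreierE F : F != fset0 ->
  schreier F <-> forall x, x \in F -> (#|` F| <= x)%N.
Proof.
move=> F0; have [mF mle] := fminP F0; split=> [[_ sF] x /mle|H].
  exact: leq_trans.
by split=> //; apply: H.
Qed.

Lemma reflectK n F : F `<=` interval 0 n -> reflect_at n (reflect_at n F) = F.
Proof.
move=> Fn; have Rn : reflect_at n F `<=` interval 0 n.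
  by apply/fsubsetP => x; rewrite in_reflect // in_interval => /andP[].
apply/fsetP => x; rewrite !in_reflect //; case: leqP => /= xn.
  by rewrite leq_subr subKn.
apply/esym/negP => xF; have := fsubsetP Fn _ xF; rewrite in_interval; lia.
Qed.

Lemma windowed_reflect k n F : F `<=` interval 0 n ->
  windowed k F -> windowed k (reflect_at n F).
Proof.
move=> Fn wF a; rewrite in_reflect // => /andP[an /wF[b ab bF]].
(* The last point of the window is at most [n], so the left end of the reflected window is not
   truncated. *)
have /(fsubsetP Fn) : (b + k).-1 \in F by apply: bF; lia.
rewrite in_interval => bn; exists (n.+1 - (b + k))%N; first by lia.
move=> i ib; rewrite in_reflect //; apply/andP; split; first by lia.
by apply: bF; lia.
Qed.

(** Under [x -> n - x] the condition [n \in F] becomes [0 \in R], and [fmin F] becomes [n - fmax R],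
    so the Schreier condition turns into [weight R <= n]. *)
Lemma card_C k n : (0 < k)%N -> #|` C k n| = #|` E k n|.
Proof.
move=> k0.
have sub0 (F : {fset nat}) : F `<=` interval 1 n -> F `<=` interval 0 n.
  move=> /fsubsetP Fn; apply/fsubsetP => x /Fn; rewrite !in_interval; lia.
suff -> : E k n = reflect_at n @` C k n.
  apply/esym/card_in_imfset => F G /= /in_C[Fn _ _ _] /in_C[Gn _ _ _] FG.
  by rewrite -(reflectK (sub0 _ Fn)) FG reflectK // sub0.
apply/fsetP => R; apply/idP/imfsetP => /=.
  move=> /in_E[R0 wR cR].
  (* Positivity makes every [x] in [R] smaller than [n], so the reflected set avoids 0. *)
  have cardR : (0 < #|` R|)%N by rewrite cardfs_gt0; apply/fset0Pn; exists 0%N.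
  have Rx x : x \in R -> (#|` R| + x <= n)%N.
    by move=> xR; apply: leq_trans wR; rewrite leq_add2l leq_fmax.
  have Rn : R `<=` interval 0 n.
    by apply/fsubsetP => x /Rx; rewrite in_interval; lia.
  exists (reflect_at n R); last by rewrite reflectK.
  have nF : n \in reflect_at n R by rewrite in_reflect // leqnn subnn.
  have F0 : reflect_at n R != fset0 by apply/fset0Pn; exists n.
  apply/in_C; split=> //.
  - apply/fsubsetP => x; rewrite in_reflect // => /andP[xn /Rx].
    rewrite in_interval; lia.
  - apply/(schreierE F0) => x; rewrite in_reflect // card_reflect //.
    move=> /andP[xn /Rx]; lia.
  - by apply/clusteredE => //; split=> //; apply: windowed_reflect.
move=> [F /in_C[/sub0 Fn nF sF /(clusteredE _ k0)[F0 cF]] ->{R}].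
have R0 : 0%N \in reflect_at n F by rewrite in_reflect // subn0.
apply/in_E; split=> //; last exact: windowed_reflect.
have := fmax_in R0; rewrite in_reflect // /weight card_reflect //.
move=> /andP[mn mF]; have := (schreierE F0).1 sF _ mF; lia.
Qed.

(** * The initial run and the least possible weight *)

Lemma windowed0 k R i : windowed k R -> 0%N \in R -> (i < k)%N -> i \in R.
(* A window of naturals containing 0 starts at 0. *)
Proof. by move=> wR /wR[b b0 bR] ik; apply: bR; lia. Qed.

Lemma weight_ge k R : (0 < k)%N -> windowed k R -> 0%N \in R ->
  (2 * k - 1 <= weight R)%N.
Proof.
move=> k0 wR R0.
have : interval 0 k.-1 `<=` R.
  apply/fsubsetP => x; rewrite in_interval => xk.
  by apply: windowed0 wR R0 _; lia.
move=> /fsubset_leq_card; rewrite card_interval.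
have /leq_fmax : k.-1 \in R by apply: windowed0 wR R0 _; lia.
by rewrite /weight; lia.
Qed.

(** * Sets whose initial run is longer than [k] *)

Definition extend (G : {fset nat}) : {fset nat} := 0%N |` shift_up 1 G.

Lemma in_extend G x : (x \in extend G) = (x == 0)%N || (x.-1 \in G).
Proof. by rewrite !inE in_shift_up subn1; case: x. Qed.

Lemma extend_inj : injective extend.
Proof.
by move=> G H /fsetP GH; apply/fsetP => x; have := GH x.+1; rewrite !in_extend.
Qed.

Lemma weight_extend G : 0%N \in G -> weight (extend G) = (weight G).+2.
Proof.
move=> G0; have mG := fmax_in G0.
rewrite /weight (@fmax_eq _ (fmax G).+1).
- by rewrite /extend cardfsU1 card_shift_up in_shift_up /=; lia.
- by rewrite in_extend mG orbT.
- move=> [|x] //; rewrite in_extend /=; exact: leq_fmax.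
Qed.

Lemma windowed_extend k G : 0%N \in G -> windowed k G -> windowed k (extend G).
Proof.
move=> G0 wG.
(* For [k = 0] windows are empty, which contradicts [0 \in G]. *)
have [k0 | k0] := posnP k; first by have [b] := wG _ G0; lia.
move=> [|a]; rewrite in_extend /=.
  move=> _; exists 0%N => // -[|i] ik; rewrite in_extend //=.
  by apply: windowed0 wG G0 _; lia.
move=> /wG[b ab bG]; exists b.+1; first by lia.
by move=> [|i] ib; rewrite in_extend //=; apply: bG; lia.
Qed.

(** Since [k \in R], the points [1, ..., k] still form a full window once 0 is deleted. *)
Lemma extendP k R : (1 < k)%N -> windowed k R -> 0%N \in R -> k \in R ->
  exists G, [/\ R = extend G, 0%N \in G & windowed k G].
Proof.
move=> k1 wR R0 kR; exists (shift_down 1 R); split.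
- apply/fsetP => -[|x]; rewrite in_extend //= in_shift_down ?addn1 //.
- by rewrite in_shift_down; apply: windowed0 wR R0 _.
move=> a; rewrite in_shift_down => /wR[b ab bR].
have [b0 | b0] := posnP b.
  (* The window at 0 loses its first point and is replaced by [1, ..., k], shifted down. *)
  exists 0%N; first by lia.
  move=> i ik; rewrite in_shift_down; have [->//|ik'] := eqVneq (i + 1)%N k.
  by apply: windowed0 wR R0 _; lia.
exists b.-1; first by lia.
by move=> i ib; rewrite in_shift_down; apply: bR; lia.
Qed.

(** * Sets whose initial run has length exactly [k] *)

Definition prepend (k t : nat) (G : {fset nat}) : {fset nat} :=
  interval 0 k.-1 `|` shift_up t G.

Lemma in_prepend k t G x : (0 < k)%N ->
  (x \in prepend k t G) = (x < k)%N || (t <= x)%N && (x - t \in G)%N.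
Proof.
by move=> k0; rewrite in_fsetU in_interval in_shift_up; congr (_ || _); lia.
Qed.

Lemma weight_prepend k t G : (0 < k < t)%N -> 0%N \in G ->
  weight (prepend k t G) = (weight G + k + t)%N.
Proof.
move=> /andP[k0 kt] G0; have mG := fmax_in G0.
have dis : interval 0 k.-1 `&` shift_up t G = fset0.
  apply/eqP/negPn/negP => /fset0Pn[x].
  by rewrite in_fsetI in_interval in_shift_up; lia.
rewrite /weight (@fmax_eq _ (fmax G + t)%N).
- rewrite /prepend cardfsU dis cardfs0 card_interval card_shift_up; lia.
- by rewrite in_prepend // addnK mG leq_addl orbT.
- move=> x; rewrite in_prepend // => /orP[|/andP[tx /leq_fmax]]; lia.
Qed.

Lemma windowed_prepend k t G : (0 < k)%N ->
  windowed k G -> windowed k (prepend k t G).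
Proof.
move=> k0 wG a; rewrite in_prepend // => /orP[ak|/andP[ta /wG[b ab bG]]].
  by exists 0%N => // i ik; rewrite in_prepend //; apply/orP; left; lia.
exists (b + t)%N; first by lia.
move=> i ib; rewrite in_prepend //; apply/orP; right; apply/andP; split.
  by lia.
by apply: bG; lia.
Qed.

(** Both [t] and [u] are the least element beyond [k] of the common set, hence equal. Two shifts are
    allowed because the shift will depend on the set. *)
Lemma prepend_inj k t u G H : (0 < k < t)%N -> (k < u)%N ->
  0%N \in G -> 0%N \in H -> prepend k t G = prepend k u H -> G = H.
Proof.
move=> /andP[k0 kt] ku G0 H0 /fsetP GH.
have tu : t = u.
  have := GH t; have := GH u; rewrite !in_prepend // !leqnn !subnn G0 H0.
  by lia.
apply/fsetP => x; have := GH (x + t)%N.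
rewrite -tu !in_prepend ?tu // leq_addl addnK /=.
by have -> : (x + u < k)%N = false by lia.
Qed.

(** The shift [t] is the least element beyond [k]. It exists because otherwise [R] lies in
    [{0, ..., k - 1}] and has weight at most [2k - 1]. *)
Lemma prependP k R : (0 < k)%N -> windowed k R -> 0%N \in R -> k \notin R ->
  (2 * k <= weight R)%N ->
  exists t G, [/\ (k < t)%N, R = prepend k t G, 0%N \in G & windowed k G].
Proof.
move=> k0 wR R0 kR Rk.
have /ex_minnP[t /andP[tR kt] tmin] : exists x, (x \in R) && (k < x)%N.
  exists (fmax R); rewrite (fmax_in R0) /= ltnNge; apply/negP => mk.
  have mR := fmax_in R0.
  have mk' : (fmax R < k)%N.
    by rewrite ltn_neqAle mk andbT; apply: contraNneq kR => <-.
  have /fsubset_leq_card : R `<=` interval 0 k.-1.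
    by apply/fsubsetP => x /leq_fmax; rewrite in_interval; lia.
  by move: Rk; rewrite card_interval /weight; lia.
exists t, (shift_down t R); split=> //.
- apply/fsetP => x; rewrite in_prepend // in_shift_down.
  have [xk|kx] /= := ltnP x k; first exact: windowed0 wR R0 _.
  have [tx|xt] /= := leqP t x; first by rewrite subnK.
  apply/negP => xR; case: (ltngtP k x) kx => // [kx _|xE _].
    by have := tmin x; rewrite xR kx => /(_ isT); lia.
  by move: kR; rewrite xE xR.
- by rewrite in_shift_down.
move=> a; rewrite in_shift_down => aR; have [b ab bR] := wR _ aR.
(* A window reaching a point beyond [k] cannot start at or before [k], as it would contain [k];
   minimality of [t] then gives [t <= b]. *)
have kb : (k < b)%N.
  rewrite ltnNge; apply/negP => bk; case/negP: kR; apply: bR.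
  by lia.
have tb : (t <= b)%N by apply: tmin; rewrite kb andbT; apply: bR; lia.
exists (b - t)%N; first by lia.
by move=> i ib; rewrite in_shift_down; apply: bR; lia.
Qed.

(** * Counting by weight *)

Lemma subset_E k m n : (m <= n)%N -> E k m `<=` E k n.
Proof.
move=> mn; apply/fsubsetP => R /in_E[R0 wR cR]; apply/in_E; split=> //.
exact: leq_trans mn.
Qed.

Lemma in_E_diff k n R : (0 < n)%N -> R \in E k n `\` E k (n - 1) <->
  [/\ 0%N \in R, weight R = n & windowed k R].
Proof.
move=> n0; rewrite in_fsetD; split.
  move=> /andP[/negP nE /in_E[R0 wR cR]]; split=> //.
  apply/eqP; rewrite eqn_leq wR leqNgt; apply/negP => Rn.
  by apply: nE; apply/in_E; split=> //; lia.
move=> [R0 wR cR]; apply/andP; split; last by apply/in_E; rewrite wR.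
by apply/negP => /in_E[_]; lia.
Qed.

Lemma E_eq0 k n : (0 < k)%N -> (n < 2 * k - 1)%N -> E k n = fset0.
Proof.
move=> k0 nk; apply/eqP/negPn/negP => /fset0Pn[R /in_E[R0 wR cR]].
by have := weight_ge k0 cR R0; lia.
Qed.

Lemma card_E_min k : (0 < k)%N -> #|` E k (2 * k - 1)| = 1%N.
Proof.
move=> k0; suff -> : E k (2 * k - 1) = [fset interval 0 k.-1] by rewrite cardfs1.
apply/fsetP => R; rewrite in_fset1; apply/idP/eqP => [/in_E[R0 wR cR]|->].
  have sub : interval 0 k.-1 `<=` R.
    apply/fsubsetP => x; rewrite in_interval => xk.
    by apply: windowed0 cR R0 _; lia.
  (* As [R] has at least [k] elements, the weight bound leaves a maximum of at most [k - 1]. *)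
  apply/esym/eqP; rewrite eqEfsubset sub; apply/fsubsetP => x /leq_fmax.
  have := fsubset_leq_card sub.
  by move: wR; rewrite card_interval in_interval /weight; lia.
apply/in_E; split.
- by rewrite in_interval.
- rewrite /weight card_interval (@fmax_eq _ k.-1) ?in_interval //; first by lia.
    by lia.
  by move=> x; rewrite in_interval; lia.
- move=> a; rewrite in_interval => ak; exists 0%N; first by lia.
  by move=> i ik; rewrite in_interval; lia.
Qed.

(** Stated additively to avoid truncated subtraction of cardinals; [D m] below collects the sets of
    weight exactly [m]. *)
Lemma card_E_rec k n : (1 < k)%N -> (2 * k <= n)%N ->
  (#|` E k n| + #|` E k (n - 3)| =
   #|` E k (n - 1)| + #|` E k (n - 2)| + #|` E k (n - (2 * k + 1))|)%N.
Proof.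
move=> k1 kn.
have k0 : (0 < k)%N by lia.
pose D m := E k m `\` E k (m - 1).
have cardD m : (#|` E k m| = #|` E k (m - 1)| + #|` D m|)%N.
  rewrite cardfsDS; last by apply: subset_E; lia.
  by rewrite subnKC //; apply/fsubset_leq_card/subset_E; lia.
(* The size of the gap inserted before [G] to reach weight [n]. *)
pose t (G : {fset nat}) := (n - k - weight G)%N.
(* The weight bound on [G] leaves a shift of at least [k + 1]. For [n = 2k] the index truncates to
   0, and [weight_ge] excludes any such [G]. *)
have tE G : G \in E k (n - (2 * k + 1)) ->
    [/\ 0%N \in G, (k < t G)%N, (weight G + k + t G)%N = n & windowed k G].
  by move=> /in_E[G0 wG cG]; have := weight_ge k0 cG G0; split=> //;
     rewrite /t; lia.
have DE : D n = (extend @` D (n - 2)) `|`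
    ((fun G => prepend k (t G) G) @` E k (n - (2 * k + 1))).
  apply/fsetP => R; apply/idP/fsetUP.
    move=> /in_E_diff[|R0 wR cR]; first by lia.
    have [kR|kR] := boolP (k \in R).
      have [G [RE G0 cG]] := extendP k1 cR R0 kR.
      left; apply/imfsetP; exists G => //=; apply/in_E_diff; first by lia.
      by split=> //; move: wR; rewrite RE weight_extend //; lia.
    have [|u [G [ku RE G0 cG]]] := prependP k0 cR R0 kR; first by lia.
    have wG : (weight G + k + u)%N = n by rewrite -wR RE weight_prepend ?k0.
    right; apply/imfsetP; exists G => /=.
      by apply/in_E; split=> //; lia.
    by rewrite RE; congr prepend; rewrite /t; lia.
  case=> /imfsetP[G /= GE ->].
    have [|G0 wG cG] := (in_E_diff _ _ _).1 GE; first by lia.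
    apply/in_E_diff; first by lia.
    by rewrite in_extend weight_extend //; split=> //;
       [lia | exact: windowed_extend].
  have [G0 kt wG cG] := tE _ GE.
  apply/in_E_diff; first by lia.
  rewrite in_prepend // k0 weight_prepend ?k0 //; split=> //.
  exact: windowed_prepend.
(* The point [k] separates the two images: [extend G] contains it, [prepend] skips it. *)
have disj : [disjoint extend @` D (n - 2) &
    ((fun G => prepend k (t G) G) @` E k (n - (2 * k + 1)))].
  apply/fdisjointP => _ /imfsetP[G /= GE ->]; apply/imfsetP => -[H /= HE].
  have [|G0 _ cG] := (in_E_diff _ _ _).1 GE; first by lia.
  have [H0 kt _ _] := tE _ HE.
  move=> /fsetP/(_ k); rewrite in_extend in_prepend // ltnn.
  have -> : k.-1 \in G by apply: windowed0 cG G0 _; lia.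
  by rewrite orbT /=; lia.
have cardDn : (#|` D n| = #|` D (n - 2)| + #|` E k (n - (2 * k + 1))|)%N.
  rewrite DE cardfsU (eqP (_ : _ `&` _ == fset0)) ?cardfs0 ?subn0 //.
  rewrite card_imfset /=; last exact: extend_inj.
  congr (_ + _)%N; apply: card_in_imfset => G H /= /tE[G0 kG _ _] /tE[H0 kH _ _].
  by apply: prepend_inj => //; rewrite k0.
(* Eliminating the cardinal of [D (n - 2)] between levels [n] and [n - 2] gives the recurrence. *)
have := cardD (n - 2)%N; have := cardD n.
rewrite cardDn (_ : (n - 2 - 1)%N = (n - 3)%N); last by rewrite -subnDA.
(* Cardinals are abstracted away because [lia] would compare them by unfolding
   [E]. *)
have arith (a b c d e f : nat) :
  (a = b + (d + e) -> c = f + d -> a + f = b + c + e)%N by lia.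
exact: arith.
Qed.

Theorem theorem1p1 (k : nat) (hk : (2 <= k)%N) :
  [/\ forall n : nat, (1 <= n <= 2 * k - 2)%N -> #|` C k n |%fset = 0%N,
      forall n : nat, (2 * k - 1 <= n <= 2 * k)%N -> #|` C k n |%fset = 1%N,
      #|` C k (2 * k + 1)%N |%fset = 2%N
    & forall n : nat, (2 * k + 2 <= n)%N ->
        (#|` C k n |%fset%:Z =
           #|` C k (n - 1)%N |%fset%:Z + #|` C k (n - 2)%N |%fset%:Z
           - #|` C k (n - 3)%N |%fset%:Z
           + #|` C k (n - (2 * k + 1))%N |%fset%:Z)%R ].
Proof.
have k0 : (0 < k)%N by lia.
(* The cardinals become an abstract sequence [e], so that only arithmetic remains. *)
have [e [eC e0 e1 erec]] : exists e : nat -> nat,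
    [/\ forall n, #|` C k n| = e n,
        forall n, (n < 2 * k - 1)%N -> e n = 0%N,
        e (2 * k - 1)%N = 1%N
      & forall n, (2 * k <= n)%N ->
          (e n + e (n - 3) = e (n - 1) + e (n - 2) + e (n - (2 * k + 1)))%N].
  exists (fun n => #|` E k n|); split=> [n|n nk||n].
  - exact: card_C.
  - by rewrite E_eq0 // cardfs0.
  - exact: card_E_min.
  - exact: card_E_rec.
(* The recurrence already holds at [2k] and [2k + 1], which yields the values 1 and 2; at [2k] its
   last index truncates to 0, where [e] vanishes. *)
have e2 : e (2 * k)%N = 1%N.
  have := erec _ (leqnn _).
  rewrite e1 (e0 (2 * k - 2)%N) ?(e0 (2 * k - 3)%N) ?(e0 (2 * k - (2 * k + 1))%N);
    lia.
have e3 : e (2 * k + 1)%N = 2%N.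
  have := erec _ (leq_addr 1 (2 * k)%N); rewrite addnK e2.
  have -> : (2 * k + 1 - 2 = 2 * k - 1)%N by lia.
  rewrite subnn e1 (e0 (2 * k + 1 - 3)%N) ?(e0 0%N); lia.
split=> [n nk|n nk||n nk]; rewrite !eC //.
- by apply: e0; lia.
- by have [->|->] : n = (2 * k - 1)%N \/ n = (2 * k)%N by lia.
- by have := erec n; lia.
Qed.
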